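(* Let $\mathbb{D}$ be a division ring, $M\ge N\ge 3$, $K\ge 1$. Let $\boldsymbol{x}:\mathbb{Z}^N\to\mathbb{D}^M$ be a quadrilateral lattice with forward data $(\boldsymbol{X}_i,H_i,Q_{ij})$, backward data $(\tilde{\boldsymbol{X}}_i,\tilde H_i,\tilde Q_{ij})$ and connection factors $\rho_i$. Let $\boldsymbol{Y}_i:\mathbb{Z}^N\to\mathbb{D}^K$ (columns) and $\boldsymbol{Y}^*_i:\mathbb{Z}^N\to(\mathbb{D}^K)^*$ (rows), $i=1,\dots,N$, satisfy $$\Delta_j\boldsymbol{Y}_i=\boldsymbol{Y}_j\,T_jQ_{ij},\qquad \Delta_i\boldsymbol{Y}^*_j=Q_{ij}\,T_i\boldsymbol{Y}^*_i,\qquad i\neq j,$$ and let $\boldsymbol{\Omega}(\boldsymbol{Y},\boldsymbol{Y}^* )$ ($K\times K$ matrix valued), $\boldsymbol{\Omega}(\boldsymbol{X},\boldsymbol{Y}^* )$ ($M\times K$ matrix valued), $\boldsymbol{\Omega}(\boldsymbol{Y},H)$ ($\mathbb{D}^K$ valued) be the potentials on $\mathbb{Z}^N$ defined by, for $i=1,\dots,N$, $$\Delta_i\boldsymbol{\Omega}(\boldsymbol{Y},\boldsymbol{Y}^* )=\boldsymbol{Y}_i\otimes T_i\boldsymbol{Y}^*_i,\quad \Delta_i\boldsymbol{\Omega}(\boldsymbol{X},\boldsymbol{Y}^* )=\boldsymbol{X}_i\otimes T_i\boldsymbol{Y}^*_i,\quad \Delta_i\boldsymbol{\Omega}(\boldsymbol{Y},H)=\boldsymbol{Y}_i\otimes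 T_iH_i .$$ If $\boldsymbol{\Omega}(\boldsymbol{Y},\boldsymbol{Y}^* )$ is invertible, then the vector function $\boldsymbol{x}':\mathbb{Z}^N\to\mathbb{D}^M$ given by $$\boldsymbol{x}'=\boldsymbol{x}-\boldsymbol{\Omega}(\boldsymbol{X},\boldsymbol{Y}^* )\boldsymbol{\Omega}(\boldsymbol{Y},\boldsymbol{Y}^* )^{-1}\boldsymbol{\Omega}(\boldsymbol{Y},H)$$ represents a quadrilateral lattice (the vectorial fundamental transform of $\boldsymbol{x}$), whose Lamé coefficients $H_i'$, normalized tangent vectors $\boldsymbol{X}_i'$ and rotation coefficients $Q_{ij}'$ are given by $$H_i'=H_i-\boldsymbol{Y}^*_i\boldsymbol{\Omega}(\boldsymbol{Y},\boldsymbol{Y}^* )^{-1}\boldsymbol{\Omega}(\boldsymbol{Y},H),$$ $$\boldsymbol{X}_i'=\boldsymbol{X}_i-\boldsymbol{\Omega}(\boldsymbol{X},\boldsymbol{Y}^* )\boldsymbol{\Omega}(\boldsymbol{Y},\boldsymbol{Y}^* )^{-1}\boldsymbol{Y}_i,$$ $$Q_{ij}'=Q_{ij}-\boldsymbol{Y}^*_j\boldsymbol{\Omega}(\boldsymbol{Y},\boldsymbol{Y}^* )^{-1}\boldsymbol{Y}_i .$$ Moreover, the backward data and the connection factors transform according to $$\tilde H_i'=\tilde H_i+\rho_i\,\boldsymbol{Y}^*_i\,\boldsymbol{\Omega}(\boldsymbol{Y},\boldsymbol{Y}^* )^{-1}\boldsymbol{\Omega}(\boldsymbol{Y},H),$$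 $$\tilde{\boldsymbol{X}}_i'=\tilde{\boldsymbol{X}}_i+\boldsymbol{\Omega}(\boldsymbol{X},\boldsymbol{Y}^* )\boldsymbol{\Omega}(\boldsymbol{Y},\boldsymbol{Y}^* )^{-1}\,\boldsymbol{Y}_i\,\rho_i^{-1},$$ $$\tilde Q_{ij}'=\tilde Q_{ij}-\rho_i\,\boldsymbol{Y}^*_i\,\boldsymbol{\Omega}(\boldsymbol{Y},\boldsymbol{Y}^* )^{-1}\,\boldsymbol{Y}_j\,\rho_j^{-1},$$ $$\rho_i'=\rho_i\bigl(1+T_i\boldsymbol{Y}^*_i\,\boldsymbol{\Omega}(\boldsymbol{Y},\boldsymbol{Y}^* )^{-1}\boldsymbol{Y}_i\bigr).$$
   Context: $\mathbb{D}$ is a division ring (not necessarily commutative). $\mathbb{D}^M$ is a right vector space of column vectors (scalars multiply on the right); $(\mathbb{D}^K)^*$ is the dual of $\mathbb{D}^K$, consisting of row vectors (scalars multiply on the left). For a column $v$ and a row $w$, $v\otimes w$ is the matrix product $vw$; for a scalar $h$, $v\otimes h=vh$. $T_i$ is the translation operator in the $i$-th direction, $(T_if)(n)=f(n+e_i)$, and $\Delta_i=T_i-\mathrm{id}$. $T_i$ acts only on the symbol or bracket immediately following it. A map $\boldsymbol{x}:\mathbb{Z}^N\to\mathbb{D}^M$ is a quadrilateral lattice (in affine description) if for all $i\ne j$ the points $\boldsymbol{x},T_i\boldsymbol{x},T_j\boldsymbol{x},T_iT_j\boldsymbol{x}$ are coplanar, at every point of $\mathbb{Z}^N$. Forward data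 of $\boldsymbol{x}$: normalized tangent vectors $\boldsymbol{X}_i:\mathbb{Z}^N\to\mathbb{D}^M$, Lamé coefficients $H_i:\mathbb{Z}^N\to\mathbb{D}$ and rotation coefficients $Q_{ij}:\mathbb{Z}^N\to\mathbb{D}$ ($i\neq j$) satisfying $$\Delta_i\boldsymbol{x}=\boldsymbol{X}_iT_iH_i,\quad \Delta_iH_j=Q_{ij}T_iH_i,\quad \Delta_j\boldsymbol{X}_i=\boldsymbol{X}_jT_jQ_{ij}\ (i\ne j),$$ together with their compatibility conditions, the discrete Darboux equations $\Delta_kQ_{ij}=Q_{kj}T_kQ_{ik}$ ($i,j,k$ distinct). Backward data $\tilde{\boldsymbol{X}}_i:\mathbb{Z}^N\to\mathbb{D}^M$ (backward tangent vectors), $\tilde H_i:\mathbb{Z}^N\to\mathbb{D}$ (backward Lamé coefficients), $\tilde Q_{ij}:\mathbb{Z}^N\to\mathbb{D}$ (backward rotation coefficients) and connection factors $\rho_i:\mathbb{Z}^N\to\mathbb{D}$ of $\boldsymbol{x}$ satisfy $$\Delta_i\tilde{\boldsymbol{X}}_j=(T_i\tilde{\boldsymbol{X}}_i)\tilde Q_{ij},\quad \Delta_i\boldsymbol{x}=(T_i\tilde{\boldsymbol{X}}_i)\tilde H_i,\quad \Delta_j\tilde H_i=(T_j\tilde Q_{ij})\tilde H_j\ (i\neq j),\quad \Delta_k\tilde Q_{ij}=(T_k\tilde Q_{ik})\tilde Q_{kj}\ (i,j,k\text{ distinct}),$$ $$\boldsymbol{X}_i=-(T_i\tilde{\boldsymbol{X}}_i)\rho_i,\qquad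 T_iH_i=-\rho_i^{-1}\tilde H_i,\qquad \rho_jT_jQ_{ij}=(T_i\tilde Q_{ji})\rho_i\ (i\ne j),$$ $$T_j\rho_i=\rho_i\bigl(1-(T_iQ_{ji})(T_jQ_{ij})\bigr)=\bigl(1-(T_j\tilde Q_{ij})(T_i\tilde Q_{ji})\bigr)\rho_i\ (i\ne j).$$
   Formalization: The printed backward formulas are false without shifts; the formal ones have T_iY*_i in place of Y*_i in H̃_i' and Q̃_ij', T_i^{-1}(Y_iρ_i^{-1}) in place of Y_iρ_i^{-1} in X̃_i', and T_j^{-1}(Y_jρ_j^{-1}) in place of Y_jρ_j^{-1} in Q̃_ij'. *)

(* Defs.v *)
From mathcomp Require Import all_boot all_order all_algebra.

Set Implicit Arguments.
Unset Strict Implicit.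
Unset Printing Implicit Defensive.

Import GRing.Theory.
Local Open Scope ring_scope.

(* [unitRingType] is noncommutative in general and satisfies 1 != 0. *)
Definition division_ring (D : unitRingType) : Prop :=
  forall a : D, a != 0 -> a \is a GRing.unit.

(* Vectors of D^M are columns ['cV[D]_M] and scalars act on the right: [v h] is
   written [v *m h%:M], the product with a 1 x 1 matrix. (MathComp's [h *: v]
   multiplies on the left; it is used only for row vectors.) *)

Definition lattice (N : nat) : Type := 'rV[int]_N.

Section Shifts.
Variables (N : nat) (V : Type).
Implicit Types (i : 'I_N) (f : lattice N -> V).

Definition T i f (n : lattice N) : V := f (n + delta_mx 0 i).

Definition Tinv i f (n : lattice N) : V := f (n - delta_mx 0 i).

End Shifts.

Definition Delta (N : nat) (V : zmodType) (i : 'I_N) (f : lattice N -> V)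
  (n : lattice N) : V := T i f n - f n.

Section Lattices.
Variables (D : unitRingType) (N M : nat).

Definition coplanar (ps : seq 'cV[D]_M) : Prop :=
  exists o u v : 'cV[D]_M,
    forall p, p \in ps -> exists s t : D, p = o + u *m s%:M + v *m t%:M.

Definition quadrilateral_lattice (x : lattice N -> 'cV[D]_M) : Prop :=
  forall (i j : 'I_N) (n : lattice N), i != j ->
    coplanar [:: x n; T i x n; T j x n; T i (T j x) n].

(* The diagonal entries [Q i i] are junk: no condition constrains them. *)
Record forward_data (x : lattice N -> 'cV[D]_M)
    (X : 'I_N -> lattice N -> 'cV[D]_M) (H : 'I_N -> lattice N -> D)
    (Q : 'I_N -> 'I_N -> lattice N -> D) : Prop := ForwardData {
  fwd_x : forall i n, Delta i x n = X i n *m (T i (H i) n)%:M;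
  fwd_H : forall i j n, i != j -> Delta i (H j) n = Q i j n * T i (H i) n;
  fwd_X : forall i j n, i != j ->
    Delta j (X i) n = X j n *m (T j (Q i j) n)%:M;
  fwd_Q : forall i j k n, i != j -> j != k -> i != k ->
    Delta k (Q i j) n = Q k j n * T k (Q i k) n
}.

Record backward_data (x : lattice N -> 'cV[D]_M)
    (X : 'I_N -> lattice N -> 'cV[D]_M) (H : 'I_N -> lattice N -> D)
    (Q : 'I_N -> 'I_N -> lattice N -> D)
    (Xt : 'I_N -> lattice N -> 'cV[D]_M) (Ht : 'I_N -> lattice N -> D)
    (Qt : 'I_N -> 'I_N -> lattice N -> D)
    (rho : 'I_N -> lattice N -> D) : Prop := BackwardData {
  (* Needed for the inverse of rho to have its usual meaning: in MathComp
     0^-1 = 0. *)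
  bwd_rho_neq0 : forall i n, rho i n != 0;
  bwd_X : forall i j n, i != j ->
    Delta i (Xt j) n = T i (Xt i) n *m (Qt i j n)%:M;
  bwd_x : forall i n, Delta i x n = T i (Xt i) n *m (Ht i n)%:M;
  bwd_H : forall i j n, i != j -> Delta j (Ht i) n = T j (Qt i j) n * Ht j n;
  bwd_Q : forall i j k n, i != j -> j != k -> i != k ->
    Delta k (Qt i j) n = T k (Qt i k) n * Qt k j n;
  conn_X : forall i n, X i n = - (T i (Xt i) n *m (rho i n)%:M);
  conn_H : forall i n, T i (H i) n = - ((rho i n)^-1 * Ht i n);
  conn_Q : forall i j n, i != j ->
    rho j n * T j (Q i j) n = T i (Qt j i) n * rho i n;
  conn_rho_fwd : forall i j n, i != j ->
    T j (rho i) n = rho i n * (1 - T i (Q j i) n * T j (Q i j) n);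
  conn_rho_bwd : forall i j n, i != j ->
    T j (rho i) n = (1 - T j (Qt i j) n * T i (Qt j i) n) * rho i n
}.

End Lattices.

(* MathComp's [invmx] requires a commutative ring. *)
Definition mx_inverse (D : unitRingType) (K : nat) (A B : 'M[D]_K) : Prop :=
  A *m B = 1%:M /\ B *m A = 1%:M.

(* The scalar w A v, for w a row and v a column. *)
Definition sandwich (D : unitRingType) (K : nat)
  (w : 'rV[D]_K) (A : 'M[D]_K) (v : 'cV[D]_K) : D := (w *m A *m v) 0 0.

(* Main.v *)
Require Import Defs.
From mathcomp Require Import all_boot all_order all_algebra.

Import GRing.Theory.
Local Open Scope ring_scope.

(* [OmInv] at [n + e_i] differs from [OmInv] at [n] by a rank-one
   matrix, and one computation then gives the difference equation of every
   transformed forward quantity. The same rank-one update gives the connection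
   formulas between the transformed forward and backward data, and shows that
   [rho'] is invertible. Finally the backward equations of any lattice follow
   from its forward equations and the connection formulas. *)

(** * Shifts on the lattice, and scalars as 1 x 1 matrices *)

Lemma T_comm {N : nat} {V : Type} (i j : 'I_N) (f : lattice N -> V) n :
  T i (T j f) n = T j (T i f) n.
Proof. by rewrite /T addrAC. Qed.

Lemma T_Tinv {N : nat} {V : Type} (i : 'I_N) (f : lattice N -> V) n :
  T i (Tinv i f) n = f n.
Proof. by rewrite /T /Tinv addrK. Qed.

Lemma T_Delta {N : nat} {V : zmodType} (i : 'I_N) (f : lattice N -> V) n :
  T i f n = f n + Delta i f n.
Proof. by rewrite /Delta addrC subrK. Qed.

(** The connection formulas reach [Xt] and [Qt] only through a shift, so equations for these are
    proved at shifted points, which exhaust the lattice. *)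
Lemma T_cover {N : nat} (i : 'I_N) (P : lattice N -> Prop) :
  (forall n, P (n + delta_mx 0 i)) -> forall n, P n.
Proof. by move=> PT n; rewrite -[n](subrK (delta_mx 0 i)). Qed.

Lemma scalar_mx11_inj {D : pzSemiRingType} (a b : D) :
  a%:M = b%:M :> 'M[D]_1 -> a = b.
Proof. by move/matrixP/(_ 0 0); rewrite !mxE. Qed.

Lemma scalar_mx11D {D : pzSemiRingType} (a b : D) :
  (a + b)%:M = a%:M + b%:M :> 'M[D]_1.
Proof. exact: raddfD. Qed.

Lemma scalar_mx11B {D : pzRingType} (a b : D) :
  (a - b)%:M = a%:M - b%:M :> 'M[D]_1.
Proof. exact: raddfB. Qed.

(** * Algebra of the scalars [sandwich w A v] *)

Section Sandwich.
Context {D : unitRingType} {K : nat}.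
Implicit Types (w : 'rV[D]_K) (A : 'M[D]_K) (v : 'cV[D]_K).

Lemma sandwich_mx w A v : (sandwich w A v)%:M = w *m A *m v.
Proof. by rewrite /sandwich -mx11_scalar. Qed.

Lemma sandwichDl w1 w2 A v :
  sandwich (w1 + w2) A v = sandwich w1 A v + sandwich w2 A v.
Proof. by rewrite /sandwich !mulmxDl mxE. Qed.

Lemma sandwichDr w A v1 v2 :
  sandwich w A (v1 + v2) = sandwich w A v1 + sandwich w A v2.
Proof. by rewrite /sandwich mulmxDr mxE. Qed.

Lemma sandwichB w A1 A2 v :
  sandwich w (A1 - A2) v = sandwich w A1 v - sandwich w A2 v.
Proof. by rewrite /sandwich mulmxBr mulmxBl !mxE. Qed.

Lemma sandwichZl c w A v : sandwich (c *: w) A v = c * sandwich w A v.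
Proof. by rewrite /sandwich -!scalemxAl mxE. Qed.

Lemma sandwichMr w A v c : sandwich w A (v *m c%:M) = sandwich w A v * c.
Proof. by apply: scalar_mx11_inj; rewrite scalar_mxM !sandwich_mx mulmxA. Qed.

(** Two scalars fuse around the rank-one matrix [v *m a], the shape to which the resolvent identity
    applies. *)
Lemma sandwichM w A v a B z :
  sandwich w A v * sandwich a B z = sandwich w (A *m (v *m a) *m B) z.
Proof. by rewrite -sandwichMr sandwich_mx /sandwich !mulmxA. Qed.

End Sandwich.

(** * Inverses under rank-one updates *)

Section RankOneUpdate.
Context {D : unitRingType} {K : nat}.

(** Resolvent identity: after expanding the difference, in each term one inverse meets its own
    matrix and cancels. *)
Lemma inverse_update {A B E F : 'M[D]_K} : mx_inverse A E -> mx_inverse B F ->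
  E *m (B - A) *m F = E - F /\ F *m (B - A) *m E = E - F.
Proof.
move=> [AE EA] [BF FB]; rewrite !mulmxBr !mulmxBl EA FB mul1mx.
by rewrite -!mulmxA BF AE !mulmx1 mul1mx.
Qed.

(* The common shape of all forward equations: it is applied with [x] a lattice,
   a Lamé coefficient, a tangent vector or a rotation coefficient. *)
Lemma dressing_increment {m n l : nat} {x x1 : 'M[D]_(m, n)} {A : 'M[D]_(m, l)}
    {b : 'M[D]_(l, n)} {u u1 : 'M[D]_(m, K)} {v v1 : 'M[D]_(K, n)}
    {Y : 'M[D]_(K, l)} {a : 'M[D]_(l, K)} {E F : 'M[D]_K} :
  E *m (Y *m a) *m F = E - F ->
  x1 - x = A *m b -> u1 - u = A *m a -> v1 - v = Y *m b ->
  x1 - u1 *m F *m v1 - (x - u *m E *m v)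
    = (A - u *m E *m Y) *m (b - a *m F *m v1).
Proof.
move=> EF hx hu hv.
rewrite mulmxBl 2!mulmxBr -hx -[u *m E *m Y *m b]mulmxA -hv.
rewrite [A *m _]mulmxA [A *m _]mulmxA -hu.
(* Only here does the resolvent identity enter; the rest is cancellation in an additive group. *)
have -> : u *m E *m Y *m (a *m F *m v1) = u *m (E - F) *m v1.
  by rewrite -EF !mulmxA.
rewrite !mulmxBr !mulmxBl.
set p := u1 *m F *m v1; set q := u *m F *m v1; set r := u *m E *m v.
set s := u *m E *m v1.
have -> : s - r - (s - q) = q - r.
  by rewrite opprB addrC addrA subrK.
rewrite !opprB -[RHS]addrA [q - p + _]addrC [r - q + _]addrA subrK.
by rewrite addrACA [RHS]addrACA [- x - p]addrC.
Qed.

Lemma dressing_increment_scalar {x x1 A b : D} {u u1 : 'rV[D]_K}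
    {v v1 Y : 'cV[D]_K} {a : 'rV[D]_K} {E F : 'M[D]_K} :
  E *m (Y *m a) *m F = E - F ->
  x1 - x = A * b -> u1 - u = A *: a -> v1 - v = Y *m b%:M ->
  x1 - sandwich u1 F v1 - (x - sandwich u E v)
    = (A - sandwich u E Y) * (b - sandwich a F v1).
Proof.
move=> EF hx hu hv; apply: scalar_mx11_inj.
rewrite scalar_mxM !scalar_mx11B !sandwich_mx.
apply: (dressing_increment EF _ _ hv).
  by rewrite -scalar_mx11B hx scalar_mxM.
by rewrite hu mul_scalar_mx.
Qed.

Section Scalar.
Context {Y : 'cV[D]_K} {a : 'rV[D]_K} {E F : 'M[D]_K}.
Hypothesis EF : E *m (Y *m a) *m F = E - F.
Hypothesis FE : F *m (Y *m a) *m E = E - F.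

(** The product of the two sandwiches is [sandwich a (E - F) v], so the factor by which [rho']
    differs from [rho] trades [F] for [E]. *)
Lemma sandwich_factorl v :
  (1 + sandwich a E Y) * sandwich a F v = sandwich a E v.
Proof.
by rewrite mulrDl mul1r sandwichM EF sandwichB addrC subrK.
Qed.

Lemma sandwich_factorr w :
  sandwich w F Y * (1 + sandwich a E Y) = sandwich w E Y.
Proof.
by rewrite mulrDr mulr1 sandwichM FE sandwichB addrC subrK.
Qed.

(** Brings a shifted transformed coefficient back to the unshifted [E] and [v]: the increment of [v]
    contributes [sandwich a E Y * b], which cancels. *)
Lemma sandwich_factor_shift v v1 b :
  v1 - v = Y *m b%:M ->
  (1 + sandwich a E Y) * (b - sandwich a F v1) = b - sandwich a E v.
Proof.
move=> hv; rewrite mulrBr sandwich_factorl -[v1](subrK v) hv sandwichDr.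
by rewrite sandwichMr mulrDl mul1r opprD addrA addrK.
Qed.

(** A Sherman-Morrison formula: the case [v = Y] of [sandwich_factorl]. Its mirror image makes the
    inverse two-sided. *)
Lemma sandwich_factorV : (1 + sandwich a E Y) * (1 - sandwich a F Y) = 1.
Proof. by rewrite mulrBr sandwich_factorl mulr1 addrK. Qed.

Lemma sandwich_factorVr : (1 - sandwich a F Y) * (1 + sandwich a E Y) = 1.
Proof. by rewrite mulrBl sandwich_factorr mul1r addrK. Qed.

Lemma sandwich_factor_unit : 1 + sandwich a E Y \is a GRing.unit.
Proof.
apply/unitrP; exists (1 - sandwich a F Y).
by rewrite sandwich_factorV sandwich_factorVr.
Qed.

Lemma mulmx_factor {m} (u : 'M[D]_(m, K)) :
  u *m F *m Y *m (1 + sandwich a E Y)%:M = u *m E *m Y.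
Proof.
rewrite scalar_mx11D mulmxDr mulmx1 sandwich_mx -!mulmxA.
have -> : F *m (Y *m (a *m (E *m Y))) = E *m Y - F *m Y.
  by rewrite -mulmxBl -FE !mulmxA.
by rewrite mulmxBr addrC subrK.
Qed.

End Scalar.

End RankOneUpdate.

(** * Linear systems for doubly shifted quantities *)

Section CrossShift.
Context {D : unitRingType} {N : nat} {Q : 'I_N -> 'I_N -> lattice N -> D}.

(** The hypotheses at [n + e_j] and [n + e_i] form a linear system in the doubly shifted [f] and
    [g], from which [g] is eliminated. A general module [V] covers both scalars and the rows
    [Ys i]. *)
Lemma cross_shift {V : lmodType D} {f g : lattice N -> V} {i j : 'I_N} {n} :
  (forall m, Delta i g m = Q i j m *: T i f m) ->
  (forall m, Delta j f m = Q j i m *: T j g m) ->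
  (1 - T i (Q j i) n * T j (Q i j) n) *: T j (T i f) n
    = T i f n + T i (Q j i) n *: T j g n.
Proof.
move=> hg hf.
have e1 : T j (T i f) n = T i f n + T i (Q j i) n *: T j (T i g) n.
  rewrite (T_comm j i f) (T_comm j i g).
  by have := T_Delta j f (n + delta_mx 0 i); rewrite hf.
have e2 : T j (T i g) n = T j g n + T j (Q i j) n *: T j (T i f) n.
  by have := T_Delta i g (n + delta_mx 0 j); rewrite hg.
by rewrite scalerBl scale1r -scalerA {1}e1 e2 scalerDr addrA addrK.
Qed.

Lemma cross_shift_scalar {f g : lattice N -> D} {i j : 'I_N} n :
  (forall m, Delta i g m = Q i j m * T i f m) ->
  (forall m, Delta j f m = Q j i m * T j g m) ->
  (1 - T i (Q j i) n * T j (Q i j) n) * T j (T i f) n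
    = T i f n + T i (Q j i) n * T j g n.
Proof. exact: (@cross_shift D^o). Qed.

End CrossShift.

(** Both sides agree after right multiplication by the unit [1 - c * d], because
    [(1 - d * c) * d = d * (1 - c * d)]. *)
Lemma cross_elim {D : unitRingType} {m : nat} {A a B b : 'cV[D]_m} {c d : D} :
  1 - c * d \is a GRing.unit ->
  A *m (1 - c * d)%:M = a + b *m d%:M ->
  B *m (1 - d * c)%:M = b + a *m c%:M ->
  A - a = B *m d%:M.
Proof.
move=> cdU hA hB.
suff e : (A - a) *m (1 - c * d)%:M = B *m d%:M *m (1 - c * d)%:M.
  have /(congr1 (mulmx^~ ((1 - c * d)^-1)%:M)) := e.
  by rewrite -!mulmxA -scalar_mxM divrr // !mulmx1.
have -> : B *m d%:M *m (1 - c * d)%:M = B *m (1 - d * c)%:M *m d%:M.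
  by rewrite -!mulmxA -!scalar_mxM mulrBl mulrBr mul1r mulr1 mulrA.
rewrite hB mulmxBl hA mulmxDl -mulmxA -scalar_mxM raddfB /= mulmxBr mulmx1.
by rewrite opprB [a + _]addrC [_ - a]addrC addrA addrK.
Qed.

Lemma mulmx_scalarK {D : unitRingType} {m : nat} {r : D} :
  r \is a GRing.unit ->
  cancel (fun v : 'cV[D]_m => v *m r%:M) (fun v => v *m (r^-1)%:M).
Proof. by move=> rU v; rewrite -mulmxA -scalar_mxM divrr // mulmx1. Qed.

(** * Backward equations from the connection formulas *)

Section Backward.
Context {D : unitRingType} {N M : nat} {x : lattice N -> 'cV[D]_M}.
Context {X : 'I_N -> lattice N -> 'cV[D]_M} {H : 'I_N -> lattice N -> D}.
Context {Q : 'I_N -> 'I_N -> lattice N -> D}.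
Context {Xt : 'I_N -> lattice N -> 'cV[D]_M} {Ht : 'I_N -> lattice N -> D}.
Context {Qt : 'I_N -> 'I_N -> lattice N -> D} {rho : 'I_N -> lattice N -> D}.

Hypothesis hfwd : forward_data x X H Q.
Hypothesis rhoU : forall i n, rho i n \is a GRing.unit.
Hypothesis cX : forall i n, X i n = - (T i (Xt i) n *m (rho i n)%:M).
Hypothesis cH : forall i n, T i (H i) n = - ((rho i n)^-1 * Ht i n).
Hypothesis cQ : forall i j n, i != j ->
  rho j n * T j (Q i j) n = T i (Qt j i) n * rho i n.
Hypothesis crho : forall i j n, i != j ->
  T j (rho i) n = rho i n * (1 - T i (Q j i) n * T j (Q i j) n).

(** Two uses of [cQ] carry the connection factor from the left of the product to its right, turning
    [Q] into [Qt]. *)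
Lemma connection_rho_bwd i j n : i != j ->
  T j (rho i) n = (1 - T j (Qt i j) n * T i (Qt j i) n) * rho i n.
Proof.
move=> ij; have ji : j != i by rewrite eq_sym.
rewrite crho // mulrBr mulrBl mulr1 mul1r mulrA cQ //.
by rewrite -[in LHS]mulrA cQ // mulrA.
Qed.

Lemma connection_unit i j n : i != j ->
  1 - T j (Qt i j) n * T i (Qt j i) n \is a GRing.unit.
Proof.
move=> ij; rewrite -(unitrMl _ (rhoU i n)) -connection_rho_bwd //.
exact: rhoU.
Qed.

Lemma connection_bwd_x i n : Delta i x n = T i (Xt i) n *m (Ht i n)%:M.
Proof.
rewrite (fwd_x hfwd) cX cH raddfN /= mulmxN mulNmx opprK -mulmxA -scalar_mxM.
by rewrite mulVKr.
Qed.

(** Once [Ht] is expressed through [rho] and [H], the factor that [crho] gives to [T j (rho i)] is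
    exactly the one that clears the double shift of [H i]. *)
Lemma connection_bwd_H i j n : i != j ->
  Delta j (Ht i) n = T j (Qt i j) n * Ht j n.
Proof.
move=> ij; have ji : j != i by rewrite eq_sym.
have HtE k m : Ht k m = - (rho k m * T k (H k) m).
  by rewrite cH mulrN opprK mulVKr.
have E : T j (Ht i) n = - (T j (rho i) n * T j (T i (H i)) n) := HtE _ _.
rewrite /Delta E HtE [Ht j n]HtE mulrN mulrA -cQ // crho // -!mulrA.
rewrite (cross_shift_scalar n (fun m => fwd_H hfwd m ij)
             (fun m => fwd_H hfwd m ji)).
by rewrite mulrDr opprD opprK addrAC addNr add0r.
Qed.

Lemma connection_bwd_X i j n : i != j ->
  Delta i (Xt j) n = T i (Xt i) n *m (Qt i j n)%:M.
Proof.
move=> ij; move: n; apply: (T_cover j) => n.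
(* Right multiplication by [rho k] turns this into the forward equation of [X k]. Its instances for
   both orders of [i] and [j] form the system that [cross_elim] solves. *)
have step k l : k != l ->
    T l (T k (Xt k)) n *m (1 - T l (Qt k l) n * T k (Qt l k) n)%:M
      = T k (Xt k) n + T l (Xt l) n *m (T k (Qt l k) n)%:M.
  move=> kl; apply: (can_inj (mulmx_scalarK (rhoU k n))).
  rewrite -mulmxA -scalar_mxM -connection_rho_bwd // mulmxDl -[in RHS]mulmxA.
  rewrite -[in RHS]scalar_mxM -cQ // [in RHS]scalar_mxM mulmxA.
  apply: oppr_inj; rewrite opprD -[- (_ *m _ *m _)]mulNmx -!cX.
  rewrite -(fwd_X hfwd n kl) /Delta [RHS]addrC subrK.
  by rewrite [RHS]/T cX.
have ji : j != i by rewrite eq_sym.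
rewrite -[LHS]/(T j (T i (Xt j)) n - T j (Xt j) n) (T_comm j i).
apply: cross_elim (step _ _ ji) (step _ _ ij); exact: connection_unit.
Qed.

Lemma connection_bwd_Q i j k n : i != j -> j != k -> i != k ->
  Delta k (Qt i j) n = T k (Qt i k) n * Qt k j n.
Proof.
move=> ij jk ik; move: n; apply: (T_cover j) => n.
(* Multiplying by [rho l] on the right and factoring [rho i] out on the left leaves the cross
   relation between [Q l i] and [Q l m]. *)
have step l m : i != l -> i != m -> l != m ->
    T m (T l (Qt i l)) n * (1 - T m (Qt l m) n * T l (Qt m l) n)
      = T l (Qt i l) n + T m (Qt i m) n * T l (Qt m l) n.
  move=> il im lm; have [li mi ml] : [/\ l != i, m != i & m != l].
    by rewrite ![_ == i]eq_sym [m == l]eq_sym.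
  apply: (mulIr (rhoU l n)); rewrite -mulrA -connection_rho_bwd // mulrDl.
  have -> : T m (T l (Qt i l)) n * T m (rho l) n
            = T m (rho i) n * T m (T i (Q l i)) n.
    exact: (esym (cQ _ _ _ li)).
  rewrite -[in RHS]mulrA -!cQ // [in RHS]mulrA -cQ //.
  rewrite crho // -!mulrA -mulrDr; congr (_ * _).
  exact: (cross_shift_scalar n (fun p => fwd_Q hfwd p lm mi li)
           (fun p => fwd_Q hfwd p li im lm)).
rewrite -[RHS]/(T j (T k (Qt i k)) n * T j (Qt k j) n).
have kj : k != j by rewrite eq_sym.
apply: scalar_mx11_inj; rewrite scalar_mxM.
rewrite -[Delta _ _ _]/(T j (T k (Qt i j)) n - T j (Qt i j) n) (T_comm j k).
rewrite scalar_mx11B.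
apply: (cross_elim (b := (T k (Qt i k) n)%:M) (connection_unit _ _ n jk)).
  by rewrite -!scalar_mxM -scalar_mx11D step.
by rewrite -!scalar_mxM -scalar_mx11D step.
Qed.

Lemma backward_of_connection : backward_data x X H Q Xt Ht Qt rho.
Proof.
split=> //.
- by move=> i n; apply/negP => /eqP r0; have := rhoU i n; rewrite r0 unitr0.
- exact: connection_bwd_X.
- exact: connection_bwd_x.
- exact: connection_bwd_H.
- exact: connection_bwd_Q.
- exact: connection_rho_bwd.
Qed.

End Backward.

(** * Coplanarity from the forward equations *)

Lemma forward_quadrilateral {D : unitRingType} {N M : nat}
    {x : lattice N -> 'cV[D]_M} {X : 'I_N -> lattice N -> 'cV[D]_M}
    {H : 'I_N -> lattice N -> D} {Q : 'I_N -> 'I_N -> lattice N -> D} :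
  forward_data x X H Q -> quadrilateral_lattice x.
Proof.
move=> hfwd i j n ij; have ji : j != i by rewrite eq_sym.
have xT k m : T k x m = x m + X k m *m (T k (H k) m)%:M.
  by rewrite T_Delta (fwd_x hfwd).
exists (x n), (X i n), (X j n) => p; rewrite !inE.
case/or4P => /eqP->.
- by exists 0, 0; rewrite raddf0 !mulmx0 !addr0.
- by exists (T i (H i) n), 0; rewrite xT raddf0 mulmx0 addr0.
- by exists 0, (T j (H j) n); rewrite xT raddf0 mulmx0 addr0.
(* Coordinates of the fourth vertex: step along [j], then along [i], and expand [T j (X i)] in [X i]
   and [X j]. *)
exists (T j (T i (H i)) n), (T j (H j) n + T j (Q i j) n * T j (T i (H i)) n).
have -> : T i (T j x) n = T j x n + T j (X i) n *m (T j (T i (H i)) n)%:M.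
  by rewrite T_comm; exact: xT.
rewrite xT (T_Delta j (X i)) (fwd_X hfwd) // mulmxDl -mulmxA -scalar_mxM.
rewrite [(_ + T j (Q i j) n * _)%:M]scalar_mx11D mulmxDr.
rewrite [in LHS]addrA [in RHS]addrA.
by congr (_ + _); rewrite addrAC.
Qed.

(** * Transformed forward data, then the transformed connection formulas *)

Theorem proposition1 (D : unitRingType) (N M K : nat)
    (hD : division_ring D) (hN : (3 <= N)%N) (hM : (N <= M)%N) (hK : (1 <= K)%N)
    (x : lattice N -> 'cV[D]_M)
    (X : 'I_N -> lattice N -> 'cV[D]_M) (H : 'I_N -> lattice N -> D)
    (Q : 'I_N -> 'I_N -> lattice N -> D)
    (Xt : 'I_N -> lattice N -> 'cV[D]_M) (Ht : 'I_N -> lattice N -> D)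
    (Qt : 'I_N -> 'I_N -> lattice N -> D) (rho : 'I_N -> lattice N -> D)
    (hx : quadrilateral_lattice x)
    (hfwd : forward_data x X H Q)
    (hbwd : backward_data x X H Q Xt Ht Qt rho)
    (Y : 'I_N -> lattice N -> 'cV[D]_K) (Ys : 'I_N -> lattice N -> 'rV[D]_K)
    (hY : forall i j n, i != j ->
      Delta j (Y i) n = Y j n *m (T j (Q i j) n)%:M)
    (hYs : forall i j n, i != j ->
      Delta i (Ys j) n = Q i j n *: T i (Ys i) n)
    (OmYY : lattice N -> 'M[D]_K) (OmXY : lattice N -> 'M[D]_(M, K))
    (OmYH : lattice N -> 'cV[D]_K)
    (hOmYY : forall i n, Delta i OmYY n = Y i n *m T i (Ys i) n)
    (hOmXY : forall i n, Delta i OmXY n = X i n *m T i (Ys i) n)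
    (hOmYH : forall i n, Delta i OmYH n = Y i n *m (T i (H i) n)%:M)
    (OmInv : lattice N -> 'M[D]_K)
    (hOmInv : forall n, mx_inverse (OmYY n) (OmInv n)) :
  let x' n := x n - OmXY n *m OmInv n *m OmYH n in
  let H' i n := H i n - sandwich (Ys i n) (OmInv n) (OmYH n) in
  let X' i n := X i n - OmXY n *m OmInv n *m Y i n in
  let Q' i j n := Q i j n - sandwich (Ys j n) (OmInv n) (Y i n) in
  let Ht' i n :=
    Ht i n + rho i n * sandwich (T i (Ys i) n) (OmInv n) (OmYH n) in
  let Xt' i n :=
    Xt i n + OmXY n *m OmInv n
             *m Tinv i (fun m => Y i m *m ((rho i m)^-1)%:M) n in
  let Qt' i j n :=
    Qt i j n - rho i n * sandwich (T i (Ys i) n) (OmInv n)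
                           (Tinv j (fun m => Y j m *m ((rho j m)^-1)%:M) n) in
  let rho' i n :=
    rho i n * (1 + sandwich (T i (Ys i) n) (OmInv n) (Y i n)) in
  [/\ quadrilateral_lattice x',
      forward_data x' X' H' Q' &
      backward_data x' X' H' Q' Xt' Ht' Qt' rho'].
Proof.
move=> x' H' X' Q' Ht' Xt' Qt' rho'.
have rhoU i n : rho i n \is a GRing.unit := hD _ (bwd_rho_neq0 hbwd i n).
(* The increment of [OmYY] is the rank-one matrix in the middle, so this is the resolvent identity
   between neighbouring points. *)
have EFs i n : OmInv n *m (Y i n *m T i (Ys i) n) *m T i OmInv n
                 = OmInv n - T i OmInv n
            /\ T i OmInv n *m (Y i n *m T i (Ys i) n) *m OmInv n
                 = OmInv n - T i OmInv n.
  rewrite -hOmYY.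
  exact: inverse_update (hOmInv n) (hOmInv (n + delta_mx 0 i)).
have EF i n := (EFs i n).1; have FE i n := (EFs i n).2.
have fwd' : forward_data x' X' H' Q'.
  (* The pairs [(u, v)] to dress with are in turn [(OmXY, OmYH)], [(Ys j, OmYH)], [(OmXY, Y i)] and
     [(Ys j, Y i)]. *)
  split=> [i n|i j n ij|i j n ij|i j k n ij jk ik].
  - have := dressing_increment (EF i n) (fwd_x hfwd i n) (hOmXY i n) (hOmYH i n).
    by rewrite -sandwich_mx -scalar_mx11B.
  - exact: dressing_increment_scalar (EF i n) (fwd_H hfwd n ij) (hYs i j n ij)
      (hOmYH i n).
  - have := dressing_increment (EF j n) (fwd_X hfwd n ij) (hOmXY j n)
      (hY i j n ij).
    by rewrite -sandwich_mx -scalar_mx11B.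
  - have kj : k != j by rewrite eq_sym.
    exact: dressing_increment_scalar (EF k n) (fwd_Q hfwd n ij jk ik)
      (hYs k j n kj) (hY i k n ik).
split=> //; first exact: forward_quadrilateral fwd'.
have gU i n : 1 + sandwich (T i (Ys i) n) (OmInv n) (Y i n) \is a GRing.unit.
  exact: sandwich_factor_unit (EF i n) (FE i n).
have rhoU' i n : rho' i n \is a GRing.unit by rewrite unitrMl.
have hg i n := sandwich_factor_shift (EF i n).
have hq i j n (ij : i != j) := hg j n _ _ _ (hY i j n ij).
apply: (backward_of_connection fwd' rhoU') => [i n|i n|i j n ij|i j n ij].
(* The shift undoes [Tinv] in [Xt'], so the inverse of [rho i] stands at [n] and cancels against
   [rho' i n]. The increment of [OmXY] then cancels the sandwich term coming from [rho']. *)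
- have -> : T i (Xt' i) n = T i (Xt i) n
      + T i OmXY n *m T i OmInv n *m (Y i n *m ((rho i n)^-1)%:M).
    by rewrite -[Y i n *m _](T_Tinv i (fun m => Y i m *m ((rho i m)^-1)%:M)).
  rewrite scalar_mxM mulmxDl !mulmxA -[_ *m (_^-1)%:M *m _]mulmxA -scalar_mxM.
  rewrite mulVr // mulmx1 (mulmx_factor (FE i n)).
  rewrite -[T i (Xt i) n *m _]opprK -(conn_X hbwd) (T_Delta i OmXY) hOmXY.
  rewrite scalar_mx11D sandwich_mx mulmxDr mulmx1 !mulmxDl !mulNmx !mulmxA.
  by rewrite addrACA addNr addr0 opprD opprK.
- apply: (mulrI (rhoU' i n)); rewrite mulrN mulVKr //.
  rewrite -mulrA (hg _ _ _ _ _ (hOmYH i n)) mulrBr (conn_H hbwd) mulrN.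
  by rewrite mulVKr // opprD.
- have ji : j != i by rewrite eq_sym.
  rewrite -mulrA hq //.
  have -> : T i (Qt' j i) n = T i (Qt j i) n
      - T i (rho j) n * sandwich (T i (T j (Ys j)) n) (T i OmInv n)
                          (Y i n *m ((rho i n)^-1)%:M).
    by rewrite -[Y i n *m _](T_Tinv i (fun m => Y i m *m ((rho i m)^-1)%:M)).
  (* The factor gained by [T i (rho j)] clears the double shift of [Ys j], leaving rows shifted
     once. *)
  rewrite (conn_rho_fwd hbwd) // -[rho j n * _ * sandwich _ _ _]mulrA.
  rewrite -sandwichZl.
  rewrite (cross_shift (fun m => hYs j i m ji) (fun m => hYs i j m ij)).
  rewrite sandwichMr (mulrA _ (rho i n)) mulrBl -(conn_Q hbwd) // -!mulrA.
  rewrite mulVr // mulr1 -mulrBr -mulrA; congr (_ * _).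
  rewrite mulrBl (sandwich_factorr (FE i n)) sandwichDl sandwichZl mulrDr mulr1.
  by rewrite opprD addrACA subrr addr0.
- have ji : j != i by rewrite eq_sym.
  rewrite -[LHS]/(T j (rho i) n * (1 + sandwich (T j (T i (Ys i)) n)
                                         (T j OmInv n) (T j (Y i) n))).
  rewrite (conn_rho_fwd hbwd) // -[in LHS]mulrA mulrDr mulr1 -sandwichZl.
  rewrite (cross_shift (fun m => hYs i j m ij) (fun m => hYs j i m ji)).
  rewrite -[in RHS]mulrA mulrBr mulr1 [in RHS]mulrA hq //.
  congr (_ * _); rewrite sandwichDl sandwichZl mulrBl opprB [in RHS]addrA.
  rewrite -[1 + _ + _ * T j (Q' i j) n]addrA.
  (* [Y i n] and the [Q i j] term rebuild [T j (Y i) n], while the resolvent identity in direction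
     [j] replaces [OmInv n] by [T j OmInv n]. *)
  have -> : sandwich (T i (Ys i) n) (OmInv n) (Y i n)
            + sandwich (T i (Ys i) n) (OmInv n) (Y j n) * T j (Q' i j) n
            = sandwich (T i (Ys i) n) (T j OmInv n) (T j (Y i) n).
    rewrite -[T j (Q' i j) n]/(T j (Q i j) n
              - sandwich (T j (Ys j) n) (T j OmInv n) (T j (Y i) n)).
    rewrite mulrBr sandwichM EF addrA -sandwichMr -sandwichDr -hY //.
    by rewrite -T_Delta sandwichB opprB addrC subrK.
  rewrite -[in RHS]/(T j (Q i j) n
            - sandwich (T j (Ys j) n) (T j OmInv n) (T j (Y i) n)).
  by rewrite mulrBr opprB addrACA [- _ + _]addrC.
Qed.
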